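(* Let $G$ be a Lie group in a Cartesian tangent category $(\mathbb X,\mathbb T)$ with Lie algebra object $\mathfrak g=T_{\mathsf e}G$. Then the Lie bracket $[,]:\mathfrak g\times\mathfrak g\to\mathfrak g$ coincides with the differential of the adjoint representation, that is, $$[,]=\mathrm{ad},$$ where $\mathrm{ad}:=(\iota_{\mathsf e}\times z_{\mathfrak g})\,T\mathrm{Ad}\;\hat p_{\mathfrak g}:\mathfrak g\times\mathfrak g\to\mathfrak g$.
   Context: Conventions. Composition is diagrammatic: $fg$ means first $f$, then $g$; $\langle f,g\rangle$ is pairing, $\pi_i$ are projections, $*$ is the terminal object and $!$ denotes maps to $*$. Tangent categories. A tangent structure $\mathbb T=(T,p,z,s,l,c)$ on a category $\mathbb X$ consists of an endofunctor $T$ and natural transformations $p_M:TM\to M$, $z_M:M\to TM$, $s_M:T_2M\to TM$, $l_M:TM\to TTM$, $c_M:TTM\to TTM$, where the $n$-fold pullback $T_nM$ of $p_M$ along itself exists and is preserved by all $T^k$, such that: $(p_M,z_M,s_M)$ is an additive bundle (a commutative monoid in $\mathbb X/M$); $(z_M,l_M):(p_M,z_M,s_M)\to(Tp_M,Tz_M,Ts_M)$ and $(\mathrm{id}_{TM},c_M):(p_{TM},z_{TM},s_{TM})\to(Tp_M,Tz_M,Ts_M)$ are additive bundle morphisms; $l_M\,Tl_M=l_M\,l_{TM}$, $c_Mc_M=\mathrm{id}$, $Tc_M\,c_{TM}\,Tc_M=c_{TM}\,Tc_M\,c_{TM}$, $l_Mc_M=l_M$, $l_{TM}\,Tc_M\,c_{TM}=c_M\,Tl_M$;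 and, with $\xi_M:=(z_{TM}\times l_M)\,Ts_M:T_2M\to TTM$, the square $\xi_M\,Tp_M=\pi_1p_Mz_M$ exhibits $T_2M$ as the pullback of $Tp_M$ along $z_M$. It is Cartesian if $\mathbb X$ has finite products and $T$ preserves them (we identify $T(A\times B)=TA\times TB$). An object $M$ admits negatives if there is $n_M:TM\to TM$ with $n_Mp_M=p_M$ and $\langle\mathrm{id},n_M\rangle s_M=p_Mz_M$. If $f:A\to TTM$ satisfies $f\,Tp_M=f\,p_{TM}p_Mz_M$, then $\{f\}:A\to TM$ denotes the unique map with $f=\langle f p_{TM}z_{TM},\{f\}l_M\rangle\,Ts_M$. Lie groups. A group object $G$ has unit $\mathsf e:*\to G$, multiplication $\mathsf m_G$, inverse $\mathsf i_G$. It is a Lie group if the pullback $T_{\mathsf e}G$ of $p_G$ along $\mathsf e$ (with inclusion $\iota_{\mathsf e}:T_{\mathsf e}G\to TG$) exists and is preserved by all $T^n$. A Lie group always admits negatives (known); so does $TG$, with negation $n_{TG}=c_G\,Tn_G\,c_G$. Differential structure on $\mathfrak g=T_{\mathsf e}G$. The tangent space is a differential object (known): it has $0,+,\lambda_{\mathfrak g}:\mathfrak g\to T\mathfrak g$ determined by $0\,\iota_{\mathsf e}=\mathsf e z_G$, $+\,\iota_{\mathsf e}=(\iota_{\mathsf e}\times\iota_{\mathsf e})s_G$, $\lambda_{\mathfrak g}\,T\iota_{\mathsf e}=\iota_{\mathsf e}l_G$; the map $(z_{\mathfrak g}\times\lambda_{\mathfrak g})\,T{+}:\mathfrak g\times\mathfrak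 g\to T\mathfrak g$ is an isomorphism, and the differential projection $\hat p_{\mathfrak g}:T\mathfrak g\to\mathfrak g$ is its inverse followed by $\pi_2$. The Lie algebra of a Lie group. An $A$-PLIVF on $G$ is a map $X:G\times A\to TG$ with $Xp_G=\pi_1$ and $(\mathsf m_G\times\mathrm{id}_A)X=(z_G\times X)\,T\mathsf m_G$. The functor $A\mapsto\mathfrak g(A)=\{A\text{-PLIVFs}\}$, $\mathfrak g(f)(X)=(\mathrm{id}_G\times f)X$, is represented by $\mathfrak g$ with universal PLIVF $\omega=(z_G\times\iota_{\mathsf e})\,T\mathsf m_G:G\times\mathfrak g\to TG$ (each $A$-PLIVF is $(\mathrm{id}_G\times\hat X)\omega$ for a unique $\hat X:A\to\mathfrak g$). For $A$-PLIVFs $X,Y$, $[X,Y]=\{\langle X,\pi_2z_A\rangle\,TY-\langle Y,\pi_2z_A\rangle\,TX\,c_G\}$, where $f-g=\langle f,g\,n_{TG}\rangle s_{TG}$; this is again an $A$-PLIVF. With $\omega_k=(\mathrm{id}_G\times\pi_k)\omega:G\times\mathfrak g\times\mathfrak g\to TG$, the Lie bracket $[,]:\mathfrak g\times\mathfrak g\to\mathfrak g$ is the unique morphism with $(\mathrm{id}_G\times[,])\omega=[\omega_1,\omega_2]$. Adjoint representation. $\mathrm{AD}:G\times G\to G$ is the conjugation action, in elements $(g,h)\mapsto ghg^{-1}$. $\mathrm{Ad}:G\times\mathfrak g\to\mathfrak g$ is the unique morphism with $\mathrm{Ad}\,\iota_{\mathsf e}=(z_G\times\iota_{\mathsf e})\,T\mathrm{AD}$.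 *)

(* Defs.v *)
From Stdlib Require Import ClassicalEpsilon.
From mathcomp Require Import all_boot.
Set Implicit Arguments.
Unset Strict Implicit.
Unset Printing Implicit Defensive.

Declare Scope cat_scope.
Delimit Scope cat_scope with cat.
Local Open Scope cat_scope.

Reserved Notation "f ;; g" (at level 50, left associativity).
Reserved Notation "⟨ f , g ⟩" (at level 0, f at level 99, g at level 99).
Reserved Notation "A ⊗ B" (at level 40, left associativity).

(* Composition is diagrammatic: [f ;; g] is first [f], then [g]. *)
Record category := Category {
  ob :> Type;
  hom : ob -> ob -> Type;
  idm : forall A, hom A A;
  comp : forall A B C, hom A B -> hom B C -> hom A C;
  comp1m : forall A B (f : hom A B), comp (idm A) f = f;
  compm1 : forall A B (f : hom A B), comp f (idm B) = f;
  compA : forall A B C D (f : hom A B) (g : hom B C) (h : hom C D),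
    comp f (comp g h) = comp (comp f g) h }.

Arguments hom {c} A B.
Arguments idm {c} A.
Notation "f ;; g" := (comp f g) : cat_scope.

(* "The unique morphism satisfying P": if no morphism satisfies P the value is
   unspecified, the argument d only witnesses that the hom-set is inhabited. *)
Definition the_hom (C : category) (A B : C) (d : hom A B)
    (P : hom A B -> Prop) : hom A B := epsilon (inhabits d) P.

Record endofunctor (C : category) := Endofunctor {
  fob :> C -> C;
  fmap : forall A B : C, hom A B -> hom (fob A) (fob B);
  fmap1 : forall A, fmap (idm A) = idm (fob A);
  fmapM : forall (A B D : C) (f : hom A B) (g : hom B D),
    fmap (f ;; g) = fmap f ;; fmap g }.

Definition idF (C : category) : endofunctor C :=
  @Endofunctor C (fun A => A) (fun A B f => f)
    (fun A => erefl) (fun A B D f g => erefl).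

Definition compF (C : category) (F H : endofunctor C) : endofunctor C :=
  @Endofunctor C (fun A => H (F A)) (fun A B f => fmap H (fmap F f))
    (fun A => etrans (congr1 (@fmap C H _ _) (fmap1 F A)) (fmap1 H (F A)))
    (fun A B D f g =>
       etrans (congr1 (@fmap C H _ _) (fmapM F f g)) (fmapM H _ _)).

Fixpoint powF (C : category) (F : endofunctor C) (k : nat) : endofunctor C :=
  if k is k'.+1 then compF (powF F k') F else idF C.

Definition is_pullback (C : category) (A B D P : C)
    (f : hom A D) (g : hom B D) (pl : hom P A) (pr : hom P B) : Prop :=
  pl ;; f = pr ;; g /\
  forall (X : C) (a : hom X A) (b : hom X B), a ;; f = b ;; g ->
    exists! u : hom X P, u ;; pl = a /\ u ;; pr = b.

(* The n-fold pullback of q along itself; b is the map down to the base, so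
   that for n = 0 this says that b is invertible. *)
Definition is_fibre_power (C : category) (E B : C) (q : hom E B) (n : nat)
    (P : C) (b : hom P B) (pr : 'I_n -> hom P E) : Prop :=
  (forall i, pr i ;; q = b) /\
  forall (X : C) (a : hom X B) (e : 'I_n -> hom X E),
    (forall i, e i ;; q = a) ->
    exists! u : hom X P, u ;; b = a /\ forall i, u ;; pr i = e i.

(* [paired pl pr s f g h] is the equation ⟨f,g⟩ s = h, where ⟨f,g⟩ is the
   pairing into an object P with projections pl, pr; it includes the assertion
   that this pairing exists. It is used with pl, pr the projections of a
   pullback, so that ⟨f,g⟩, hence h, is unique. *)
Definition paired (C : category) (P E D X : C) (pl pr : hom P E) (s : hom P D)
    (f g : hom X E) (h : hom X D) : Prop :=
  exists u : hom X P, [/\ u ;; pl = f, u ;; pr = g & u ;; s = h].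

Record tangent_data (C : category) := TangentData {
  tan :> endofunctor C;
  tp : forall M : C, hom (tan M) M;
  tz : forall M : C, hom M (tan M);
  tl : forall M : C, hom (tan M) (tan (tan M));
  tc : forall M : C, hom (tan (tan M)) (tan (tan M));
  tpow : nat -> C -> C;
  tpow_base : forall n (M : C), hom (tpow n M) M;
  tpow_proj : forall n (M : C), 'I_n -> hom (tpow n M) (tan M);
  ts : forall M : C, hom (tpow 2 M) (tan M) }.

Arguments tp {C} t M.
Arguments tz {C} t M.
Arguments tl {C} t M.
Arguments tc {C} t M.
Arguments ts {C} t M.

Section TangentStructure.
Context (C : category) (T : tangent_data C).
Notation p := (tp T).
Notation z := (tz T).
Notation s := (ts T).
Notation l := (tl T).
Notation c := (tc T).

Definition t2_fst (M : C) : hom (tpow T 2 M) (T M) := tpow_proj T M ord0.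
Definition t2_snd (M : C) : hom (tpow T 2 M) (T M) := tpow_proj T M ord_max.

(* ⟨f,g⟩ s_M = h *)
Definition sum_is (M X : C) (f g h : hom X (T M)) : Prop :=
  paired (t2_fst M) (t2_snd M) (s M) f g h.

(* ⟨f,g⟩ T(s_M) = h, the pairing being into the pullback T(T_2 M) *)
Definition Tsum_is (M X : C) (f g h : hom X (T (T M))) : Prop :=
  paired (fmap T (t2_fst M)) (fmap T (t2_snd M)) (fmap T (s M)) f g h.

Record is_tangent_structure : Prop := IsTangentStructure {
  tp_nat : forall (M N : C) (f : hom M N), fmap T f ;; p N = p M ;; f;
  tz_nat : forall (M N : C) (f : hom M N), f ;; z N = z M ;; fmap T f;
  ts_nat : forall (M N : C) (f : hom M N),
    sum_is (t2_fst M ;; fmap T f) (t2_snd M ;; fmap T f) (s M ;; fmap T f);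
  tl_nat : forall (M N : C) (f : hom M N),
    fmap T f ;; l N = l M ;; fmap T (fmap T f);
  tc_nat : forall (M N : C) (f : hom M N),
    fmap T (fmap T f) ;; c N = c M ;; fmap T (fmap T f);
  tpow_pullback : forall (k n : nat) (M : C),
    is_fibre_power (fmap (powF T k) (p M)) (fmap (powF T k) (tpow_base T n M))
      (fun i => fmap (powF T k) (tpow_proj T M i));
  (* (p, z, s) is an additive bundle *)
  tz_p : forall M, z M ;; p M = idm M;
  ts_p : forall M, s M ;; p M = tpow_base T 2 M;
  tsum0m : forall (M X : C) (f : hom X (T M)), sum_is (f ;; p M ;; z M) f f;
  tsumC : forall (M X : C) (f g h : hom X (T M)), sum_is f g h -> sum_is g f h;
  tsumA : forall (M X : C) (f1 f2 f3 f12 f23 h : hom X (T M)),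
    sum_is f1 f2 f12 -> sum_is f2 f3 f23 -> sum_is f12 f3 h -> sum_is f1 f23 h;
  (* (z, l) is an additive bundle morphism *)
  tl_Tp : forall M, l M ;; fmap T (p M) = p M ;; z M;
  tz_l : forall M, z M ;; l M = z M ;; fmap T (z M);
  ts_l : forall M, Tsum_is (t2_fst M ;; l M) (t2_snd M ;; l M) (s M ;; l M);
  (* (id, c) is an additive bundle morphism *)
  tc_Tp : forall M, c M ;; fmap T (p M) = p (T M);
  tz_c : forall M, z (T M) ;; c M = fmap T (z M);
  ts_c : forall M,
    Tsum_is (t2_fst (T M) ;; c M) (t2_snd (T M) ;; c M) (s (T M) ;; c M);
  tl_Tl : forall M, l M ;; fmap T (l M) = l M ;; l (T M);
  tc_c : forall M, c M ;; c M = idm (T (T M));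
  tc_braid : forall M,
    fmap T (c M) ;; c (T M) ;; fmap T (c M)
    = c (T M) ;; fmap T (c M) ;; c (T M);
  tl_c : forall M, l M ;; c M = l M;
  tl_Tc_c : forall M, l (T M) ;; fmap T (c M) ;; c (T M) = c M ;; fmap T (l M);
  (* universality of the vertical lift *)
  tl_universal : forall M, exists xi : hom (tpow T 2 M) (T (T M)),
    Tsum_is (t2_fst M ;; z (T M)) (t2_snd M ;; l M) xi /\
    is_pullback (fmap T (p M)) (z M) xi (t2_fst M ;; p M) }.

(* n_M, for an object M that admits negatives *)
Definition is_negation (M : C) (n : hom (T M) (T M)) : Prop :=
  n ;; p M = p M /\ sum_is (idm (T M)) n (p M ;; z M).

Definition tneg (M : C) : hom (T M) (T M) :=
  the_hom (idm (T M)) (@is_negation M).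

(* n_{TM} *)
Definition tnegT (M : C) : hom (T (T M)) (T (T M)) :=
  c M ;; fmap T (tneg M) ;; c M.

(* f - g, for f, g : A -> TTM *)
Definition tsub (M A : C) (f g : hom A (T (T M))) : hom A (T (T M)) :=
  the_hom f (fun h => sum_is f (g ;; tnegT M) h).

(* {f} *)
Definition tbrace (M A : C) (f : hom A (T (T M))) : hom A (T M) :=
  the_hom (f ;; p (T M))
    (fun g => Tsum_is (f ;; p (T M) ;; z (T M)) (g ;; l M) f).

End TangentStructure.

Record finite_products (C : category) := FiniteProducts {
  one : C;
  bang : forall A : C, hom A one;
  bang_uniq : forall (A : C) (f : hom A one), f = bang A;
  prd : C -> C -> C;
  fstm : forall A B, hom (prd A B) A;
  sndm : forall A B, hom (prd A B) B;
  pairm : forall X A B, hom X A -> hom X B -> hom X (prd A B);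
  pairm_fst : forall X A B (f : hom X A) (g : hom X B),
    pairm f g ;; fstm A B = f;
  pairm_snd : forall X A B (f : hom X A) (g : hom X B),
    pairm f g ;; sndm A B = g;
  pairm_uniq : forall X A B (u : hom X (prd A B)),
    u = pairm (u ;; fstm A B) (u ;; sndm A B) }.

(* T preserves finite products: the canonical maps T(A ⊗ B) -> TA ⊗ TB and
   T* -> * have inverses [tprd] and [tone]. *)
Record cartesian_tangent_category := CartesianTangentCategory {
  ctc :> category;
  ctc_prod : finite_products ctc;
  ctc_tan : tangent_data ctc;
  ctc_tanP : is_tangent_structure ctc_tan;
  tprd : forall A B : ctc,
    hom (prd ctc_prod (ctc_tan A) (ctc_tan B)) (ctc_tan (prd ctc_prod A B));
  tprdK : forall A B : ctc,
    tprd A B ;; pairm ctc_prod (fmap ctc_tan (fstm ctc_prod A B))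
                               (fmap ctc_tan (sndm ctc_prod A B)) = idm _;
  tprdVK : forall A B : ctc,
    pairm ctc_prod (fmap ctc_tan (fstm ctc_prod A B))
                   (fmap ctc_tan (sndm ctc_prod A B)) ;; tprd A B = idm _;
  tone : hom (one ctc_prod) (ctc_tan (one ctc_prod));
  toneK : tone ;; bang ctc_prod (ctc_tan (one ctc_prod)) = idm _;
  toneVK : bang ctc_prod (ctc_tan (one ctc_prod)) ;; tone = idm _ }.

Notation "⟨ f , g ⟩" := (pairm (ctc_prod _) f g) : cat_scope.
Notation "A ⊗ B" := (prd (ctc_prod _) A B) : cat_scope.

Section LieGroups.
Context (X : cartesian_tangent_category).
Notation T := (ctc_tan X).
Notation p := (tp T).
Notation z := (tz T).
Notation l := (tl T).
Notation c := (tc T).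
Notation "*1" := (one (ctc_prod X)).
Notation "'!' A" := (bang (ctc_prod X) A) (at level 9, A at level 8).
Notation π1 := (fstm (ctc_prod X) _ _).
Notation π2 := (sndm (ctc_prod X) _ _).

Record group_object := GroupObject {
  gob :> X;
  gunit : hom *1 gob;
  gmul : hom (gob ⊗ gob) gob;
  ginv : hom gob gob;
  gmulA : forall (A : X) (f g h : hom A gob),
    ⟨f, ⟨g, h⟩ ;; gmul⟩ ;; gmul = ⟨⟨f, g⟩ ;; gmul, h⟩ ;; gmul;
  gmul1m : forall (A : X) (f : hom A gob), ⟨!A ;; gunit, f⟩ ;; gmul = f;
  gmulm1 : forall (A : X) (f : hom A gob), ⟨f, !A ;; gunit⟩ ;; gmul = f;
  gmulVm : forall (A : X) (f : hom A gob),
    ⟨f ;; ginv, f⟩ ;; gmul = !A ;; gunit;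
  gmulmV : forall (A : X) (f : hom A gob),
    ⟨f, f ;; ginv⟩ ;; gmul = !A ;; gunit }.

(* [lie G] is T_e G and [liei G] its inclusion into T G. *)
Record lie_group := LieGroup {
  lgrp :> group_object;
  lie : X;
  liei : hom lie (T lgrp);
  lie_pullback : forall k : nat,
    is_pullback (fmap (powF T k) (p lgrp)) (fmap (powF T k) (gunit lgrp))
      (fmap (powF T k) liei) (fmap (powF T k) (!lie)) }.

(* ⟨f, g⟩ as a map into T(A ⊗ B), under T(A ⊗ B) = TA ⊗ TB *)
Definition Tpair (Y A B : X) (f : hom Y (T A)) (g : hom Y (T B)) :
  hom Y (T (A ⊗ B)) := ⟨f, g⟩ ;; tprd A B.

Context (G : lie_group).
Notation g := (lie G).
Notation ι := (liei G).
Notation m := (gmul G).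
Notation i := (ginv G).

Definition lie_add : hom (g ⊗ g) g :=
  the_hom π1 (fun a => sum_is (π1 ;; ι) (π2 ;; ι) (a ;; ι)).

Definition lie_lift : hom g (T g) :=
  the_hom (z g) (fun v => v ;; fmap T ι = ι ;; l G).

(* (z × λ) T(+) *)
Definition lie_split : hom (g ⊗ g) (T g) :=
  Tpair (π1 ;; z g) (π2 ;; lie_lift) ;; fmap T lie_add.

Definition lie_split_inv : hom (T g) (g ⊗ g) :=
  the_hom ⟨p g, p g⟩
    (fun v => v ;; lie_split = idm (T g) /\ lie_split ;; v = idm (g ⊗ g)).

Definition diff_proj : hom (T g) g := lie_split_inv ;; π2.

(* A-parametrized left-invariant vector fields on G *)
Definition plivf (A : X) (V : hom (G ⊗ A) (T G)) : Prop :=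
  V ;; p G = π1 /\
  (* both sides are maps (G ⊗ G) ⊗ A -> TG *)
  ⟨π1 ;; m, π2⟩ ;; V
  = Tpair (π1 ;; π1 ;; z G) (⟨π1 ;; π2, π2⟩ ;; V) ;; fmap T m.

Definition univ_plivf : hom (G ⊗ g) (T G) :=
  Tpair (π1 ;; z G) (π2 ;; ι) ;; fmap T m.

(* Meaningful when V and W satisfy [plivf]; c_G is applied to the second term
   only. *)
Definition plivf_bracket (A : X) (V W : hom (G ⊗ A) (T G)) :
    hom (G ⊗ A) (T G) :=
  tbrace (tsub (Tpair V (π2 ;; z A) ;; fmap T W)
               (Tpair W (π2 ;; z A) ;; fmap T V ;; c G)).

Definition lie_bracket : hom (g ⊗ g) g :=
  the_hom π1 (fun b =>
    ⟨π1, π2 ;; b⟩ ;; univ_plivf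
    = plivf_bracket (⟨π1, π2 ;; π1⟩ ;; univ_plivf)
                    (⟨π1, π2 ;; π2⟩ ;; univ_plivf)).

(* (g, h) |-> g h g^-1 *)
Definition conj_action : hom (G ⊗ G) G := ⟨m, π1 ;; i⟩ ;; m.

Definition Ad : hom (G ⊗ g) g :=
  the_hom π2 (fun a =>
    a ;; ι = Tpair (π1 ;; z G) (π2 ;; ι) ;; fmap T conj_action).

Definition ad : hom (g ⊗ g) g :=
  Tpair (π1 ;; ι) (π2 ;; z g) ;; fmap T Ad ;; diff_proj.

End LieGroups.

(* Main.v *)
(* For a, b in T_e G and g in G, write A = a T(z), B = b z and o for the zero
   vector of TTG over g, and multiply in the group TTG, on which both additions
   are group homomorphisms. The two terms of the bracket of the left-invariant
   fields of a and b are o A B and o B A. By definition of ad,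
   A B A^-1 = B + L with + the addition of Tp and L = ad(a,b) l, so that
   o A B = (o (B + L)) A. Since A p = 1, multiplicativity of the addition of
   p_TG gives o (B + L) A = o (B + L) + o B A for that other addition: the
   difference is o (B + L) = o B + o L, whose brace is the left-invariant field
   of ad(a,b). *)
From Stdlib Require Import ClassicalEpsilon.
From mathcomp Require Import all_boot.
Require Import Defs.
Set Implicit Arguments.
Unset Strict Implicit.
Unset Printing Implicit Defensive.
Local Open Scope cat_scope.

(** * Unique choice and maps into pullbacks *)

Lemma the_hom_eq (C : category) (A B : C) (d : hom A B) (P : hom A B -> Prop)
    (f : hom A B) :
  P f -> (forall f', P f' -> f' = f) -> the_hom d P = f.
Proof.
by move=> Pf; apply; apply: (epsilon_spec (inhabits d)); exists f.
Qed.

Lemma the_hom_spec (C : category) (A B : C) (d : hom A B)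
    (P : hom A B -> Prop) (f : hom A B) :
  P f -> P (the_hom d P).
Proof. by move=> Pf; apply: (epsilon_spec (inhabits d)); exists f. Qed.

Lemma is_pullback_eq (C : category) (A B D P : C) (f : hom A D) (g : hom B D)
    (pl : hom P A) (pr : hom P B) (Y : C) (u v : hom Y P) :
  is_pullback f g pl pr -> u ;; pl = v ;; pl -> u ;; pr = v ;; pr -> u = v.
Proof.
case=> comm univ el er.
have [|w [_ w_uniq]] := univ Y (u ;; pl) (u ;; pr).
  by rewrite -!compA comm.
by rewrite -(w_uniq u) // -(w_uniq v).
Qed.

(** * The two additions on TTM, the vertical lift and subtraction *)

Section TangentCategory.
Context (C : category) (T : tangent_data C) (TP : is_tangent_structure T).
Notation p := (tp T).
Notation z := (tz T).
Notation l := (tl T).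
Notation c := (tc T).

Lemma t2_p (M : C) :
  t2_fst T M ;; p M = tpow_base T 2 M /\ t2_snd T M ;; p M = tpow_base T 2 M.
Proof. by have [pr_p _] := tpow_pullback TP 0 2 M; split; apply: pr_p. Qed.

(** [powF T 0] unfolds to the identity functor, so the case k = 0 of [tpow_pullback] concerns [p M]
    itself; the family indexed by ['I_2] is traded for two maps. *)
Lemma t2_pullback (M : C) :
  is_pullback (p M) (p M) (t2_fst T M) (t2_snd T M).
Proof.
have [pr_p univ] := tpow_pullback TP 0 2 M.
split=> [|Y f g fg]; first by case: (t2_p M) => -> ->.
have [|u [[ub ue] u_uniq]] :=
    univ Y (f ;; p M) (fun i : 'I_2 => if i == ord0 then f else g).
  by move=> i; case: ifP => _.
exists u; split; first by split; [exact: (ue ord0) | exact: (ue ord_max)].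
move=> v [vf vg]; apply: u_uniq; split=> [|i].
  by rewrite /= -(proj1 (t2_p M)) compA vf.
(* The remaining index has value 1, so it equals [ord_max] up to the proof of its bound. *)
case: ifP => [/eqP -> //|]; case: i => [[|[|[]]] //= lti _].
by rewrite -vg; congr (_ ;; tpow_proj _ _ _); apply: val_inj.
Qed.

Lemma Tt2_pullback (M : C) :
  is_pullback (fmap T (p M)) (fmap T (p M))
    (fmap T (t2_fst T M)) (fmap T (t2_snd T M)).
Proof.
have [pr_p univ] := tpow_pullback TP 1 2 M.
split=> [|Y f g fg]; first by rewrite -!fmapM; case: (t2_p M) => -> ->.
have [|u [[ub ue] u_uniq]] :=
    univ Y (f ;; fmap T (p M)) (fun i : 'I_2 => if i == ord0 then f else g).
  by move=> i; case: ifP => _.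
exists u; split; first by split; [exact: (ue ord0) | exact: (ue ord_max)].
move=> v [vf vg]; apply: u_uniq; split=> [|i].
  by rewrite /= -(proj1 (t2_p M)) fmapM compA vf.
case: ifP => [/eqP -> //|]; case: i => [[|[|[]]] //= lti _].
by rewrite -vg; congr (_ ;; fmap _ (tpow_proj _ _ _)); apply: val_inj.
Qed.

Section Sums.
Context (M Y : C).
Implicit Types f g h : hom Y (T M).

Lemma sum_isE f g h h' : sum_is f g h -> sum_is f g h' -> h = h'.
Proof.
move=> [u [uf ug <-]] [v [vf vg <-]]; congr (_ ;; _).
by apply: is_pullback_eq (t2_pullback M) _ _; rewrite ?uf ?ug.
Qed.

Lemma sum_is_ex f g : f ;; p M = g ;; p M -> exists h, sum_is f g h.
Proof.
move=> /(proj2 (t2_pullback M) _ _) [u [[uf ug] _]].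
by exists (u ;; ts T M), u.
Qed.

Lemma sum_is_p f g h : sum_is f g h -> f ;; p M = h ;; p M /\ g ;; p M = h ;; p M.
Proof.
case: (t2_p M) => fp gp [u [<- <- <-]].
by rewrite -!compA fp gp (ts_p TP).
Qed.

Lemma sum_is_pre Z (k : hom Z Y) f g h :
  sum_is f g h -> sum_is (k ;; f) (k ;; g) (k ;; h).
Proof. by move=> [u [<- <- <-]]; exists (k ;; u); rewrite !compA. Qed.

Lemma Tsum_is_pre Z (k : hom Z Y) (f g h : hom Y (T (T M))) :
  Tsum_is f g h -> Tsum_is (k ;; f) (k ;; g) (k ;; h).
Proof. by move=> [u [<- <- <-]]; exists (k ;; u); rewrite !compA. Qed.

Lemma sum_is_fmap N (k : hom M N) f g h :
  sum_is f g h -> sum_is (f ;; fmap T k) (g ;; fmap T k) (h ;; fmap T k).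
Proof.
move=> [u [<- <- <-]]; have [v [vf vg vs]] := ts_nat TP k.
by exists (u ;; v); rewrite -!compA vf vg vs.
Qed.

Lemma sum_isx0 f : sum_is f (f ;; p M ;; z M) f.
Proof. by apply: (tsumC TP); apply: (tsum0m TP). Qed.

Lemma sum_is0 (x : hom Y M) : sum_is (x ;; z M) (x ;; z M) (x ;; z M).
Proof. by have := sum_isx0 (x ;; z M); rewrite -(compA x) (tz_p TP) compm1. Qed.

End Sums.

Lemma fmap_sum_is (M Y : C) (f g h : hom Y (T M)) :
  sum_is f g h -> Tsum_is (fmap T f) (fmap T g) (fmap T h).
Proof. by move=> [u [<- <- <-]]; exists (fmap T u); rewrite !fmapM. Qed.

Lemma tc_p (M : C) : c M ;; p (T M) = fmap T (p M).
Proof. by rewrite -(tc_Tp TP) compA (tc_c TP) comp1m. Qed.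

Lemma Tz_c (M : C) : fmap T (z M) ;; c M = z (T M).
Proof. by rewrite -(tz_c TP) -compA (tc_c TP) compm1. Qed.

Lemma Tsum_isE (M Y : C) (f g h h' : hom Y (T (T M))) :
  Tsum_is f g h -> Tsum_is f g h' -> h = h'.
Proof.
move=> [u [uf ug <-]] [v [vf vg <-]]; congr (_ ;; _).
by apply: is_pullback_eq (Tt2_pullback M) _ _; rewrite ?uf ?ug.
Qed.

Lemma Tsum_is_Tp (M Y : C) (f g h : hom Y (T (T M))) :
  Tsum_is f g h ->
  f ;; fmap T (p M) = h ;; fmap T (p M) /\ g ;; fmap T (p M) = h ;; fmap T (p M).
Proof.
case: (t2_p M) => fp gp [u [<- <- <-]].
by rewrite -!compA -!fmapM fp gp (ts_p TP).
Qed.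

Lemma sum_is_c (M Y : C) (f g h : hom Y (T (T M))) :
  sum_is f g h -> Tsum_is (f ;; c M) (g ;; c M) (h ;; c M).
Proof.
move=> [u [<- <- <-]]; have := Tsum_is_pre u (ts_c TP M).
by rewrite !compA.
Qed.

(** As [c] is an involution, [sum_is_c] carries the sum of the two images back to the given sum;
    base points agree because [c] exchanges [p (T M)] and [fmap T (p M)]. *)
Lemma Tsum_is_c (M Y : C) (f g h : hom Y (T (T M))) :
  Tsum_is f g h -> sum_is (f ;; c M) (g ;; c M) (h ;; c M).
Proof.
move=> fgh; have [fp gp] := Tsum_is_Tp fgh.
have [|w fgw] := @sum_is_ex (T M) Y (f ;; c M) (g ;; c M).
  by rewrite -!compA tc_p fp gp.
suff <- : w = h ;; c M by [].
have := sum_is_c fgw; rewrite -!compA (tc_c TP) !compm1 => /(Tsum_isE fgh) ->.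
by rewrite -compA (tc_c TP) compm1.
Qed.

Lemma Tsum_is_l (M Y : C) (f g h : hom Y (T M)) :
  sum_is f g h -> Tsum_is (f ;; l M) (g ;; l M) (h ;; l M).
Proof.
move=> [u [<- <- <-]]; have := Tsum_is_pre u (ts_l TP M).
by rewrite !compA.
Qed.

Lemma tl_p (M : C) : l M ;; p (T M) = p M ;; z M.
Proof. by rewrite -(tl_c TP) -compA tc_p (tl_Tp TP). Qed.

(** Composing with [c] and then with [fmap T (p M)] turns the sum into f plus the zero vector
    [g ;; p M ;; z M], with value [h ;; p (T M)]. *)
Lemma Tsum_is_lift_p (M Y : C) (f g : hom Y (T M)) (h : hom Y (T (T M))) :
  Tsum_is (f ;; z (T M)) (g ;; l M) h -> h ;; p (T M) = f /\ f ;; p M = g ;; p M.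
Proof.
move=> /Tsum_is_c /(sum_is_fmap (p M)).
rewrite -!compA (tc_Tp TP) (tz_p TP) tl_p !compm1 compA => s.
have fg : f ;; p M = g ;; p M.
  by have [-> <-] := sum_is_p s; rewrite -compA (tz_p TP) compm1.
by split=> //; rewrite -fg in s; apply: (sum_isE s (sum_isx0 f)).
Qed.

(** Uniqueness half of the universality of the vertical lift: both pairs factor h through xi, and
    [Tsum_is_lift_p] makes their first components equal, so the pullback identifies the
    factorizations. *)
Lemma Tsum_is_lift_inj (M Y : C) (f f' g g' : hom Y (T M))
    (h : hom Y (T (T M))) :
  Tsum_is (f ;; z (T M)) (g ;; l M) h -> Tsum_is (f' ;; z (T M)) (g' ;; l M) h ->
  f = f' /\ g = g'.
Proof.
have [xi [xi_sum xi_pb]] := tl_universal TP M.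
have factor f1 g1 : Tsum_is (f1 ;; z (T M)) (g1 ;; l M) h ->
    exists u, [/\ u ;; t2_fst T M = f1, u ;; t2_snd T M = g1 & u ;; xi = h].
  move=> sh; have [_ /(proj2 (t2_pullback M) _ _) [u [[uf ug] _]]] :=
    Tsum_is_lift_p sh.
  exists u; split=> //; apply: Tsum_isE sh; rewrite -uf -ug -!compA.
  exact: Tsum_is_pre.
move=> sh sh'; have [hf _] := Tsum_is_lift_p sh.
have [hf' _] := Tsum_is_lift_p sh'.
move: sh sh' => /factor [u [uf <- uh]] /factor [v [vf <- vh]].
have ff : f = f' by rewrite -hf.
suff -> : u = v by [].
apply: (is_pullback_eq xi_pb); first by rewrite uh vh.
by rewrite !compA uf vf ff.
Qed.

(** Existence half of the universality. The base point x is a separate argument so that g is known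
    to lie over it; for x the unit of a Lie group, g then lands in the Lie algebra. *)
Lemma Tsum_is_lift_ex (M Y : C) (f : hom Y (T (T M))) (x : hom Y M) :
  f ;; fmap T (p M) = x ;; z M ->
  exists g : hom Y (T M),
    Tsum_is (f ;; p (T M) ;; z (T M)) (g ;; l M) f /\ g ;; p M = x.
Proof.
have [xi [xi_sum xi_pb]] := tl_universal TP M.
move=> /(proj2 xi_pb _ _) [u [[<- <-] _]].
have [xi_p fg] := Tsum_is_lift_p xi_sum.
exists (u ;; t2_snd T M); split; last by rewrite -!compA fg.
by have := Tsum_is_pre u xi_sum; rewrite -(compA u xi) xi_p !compA.
Qed.

Lemma tbraceE (M Y : C) (f : hom Y (T (T M))) (h : hom Y (T M)) :
  Tsum_is (f ;; p (T M) ;; z (T M)) (h ;; l M) f -> tbrace f = h.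
Proof.
by move=> fh; apply: the_hom_eq => // h' /Tsum_is_lift_inj /(_ fh) [].
Qed.

Section Negation.
Context (M : C) (n : hom (T M) (T M)) (nP : is_negation n).

Lemma tneg_spec : is_negation (tneg T M).
Proof. exact: the_hom_spec nP. Qed.

(** T applied to v + (-v) = 0 gives an identity for the addition of Tp; conjugation by [c] moves it
    to the addition of [p (T M)]. *)
Lemma tnegT_spec : sum_is (idm _) (tnegT T M) (p (T M) ;; z (T M)).
Proof.
have [_ /fmap_sum_is /(Tsum_is_pre (c M)) /Tsum_is_c] := tneg_spec.
rewrite fmap1 compm1 (tc_c TP) fmapM -(compA (c M)) -compA -compA.
by rewrite Tz_c !compA (tc_Tp TP).
Qed.

(** Adding -g to h + g and reassociating leaves h + 0. Differences can thus be checked as sums,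
    without computing [tnegT]. *)
Lemma tsubE (Y : C) (f g h : hom Y (T (T M))) : sum_is h g f -> tsub f g = h.
Proof.
move=> hgf; have gn := sum_is_pre g tnegT_spec; rewrite compm1 in gn.
have [gp np] := sum_is_p gn; have [hp gp'] := sum_is_p hgf.
have [|k fk] := @sum_is_ex (T M) Y f (g ;; tnegT T M).
  by rewrite np -gp gp'.
have kE : k = h.
  have := tsumA TP hgf gn fk; rewrite compA gp' -hp => hk.
  exact: sum_isE hk (sum_isx0 h).
by rewrite kE in fk; apply: the_hom_eq => // k' /sum_isE; apply.
Qed.

End Negation.

End TangentCategory.

(** * Pairing into products and their tangent objects *)

Section Products.
Context (X : cartesian_tangent_category).
Notation T := (ctc_tan X).
Notation TP := (ctc_tanP X).
Notation π1 := (fstm (ctc_prod X) _ _).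
Notation π2 := (sndm (ctc_prod X) _ _).
Notation "'!' A" := (bang (ctc_prod X) A) (at level 9, A at level 8).

Lemma pair_eq (Y A B : X) (u v : hom Y (A ⊗ B)) :
  u ;; π1 = v ;; π1 -> u ;; π2 = v ;; π2 -> u = v.
Proof. by move=> e1 e2; rewrite (pairm_uniq u) (pairm_uniq v) e1 e2. Qed.

Lemma pair_pre (Z Y A B : X) (k : hom Z Y) (f : hom Y A) (g : hom Y B) :
  k ;; ⟨f, g⟩ = ⟨k ;; f, k ;; g⟩.
Proof. by apply: pair_eq; rewrite -compA !(pairm_fst, pairm_snd). Qed.

Lemma bang_eq (Y : X) (f g : hom Y (one (ctc_prod X))) : f = g.
Proof. by rewrite (bang_uniq f) (bang_uniq g). Qed.

Lemma Tone_eq (Y : X) (f g : hom Y (T (one (ctc_prod X)))) : f = g.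
Proof.
rewrite -(compm1 f) -(compm1 g) -(toneVK X) !compA; congr (_ ;; _).
exact: bang_eq.
Qed.

Lemma tprd_fst (A B : X) : tprd A B ;; fmap T π1 = π1.
Proof.
rewrite -(pairm_fst (ctc_prod X) (fmap T π1) (fmap T π2)).
by rewrite compA tprdK comp1m.
Qed.

Lemma tprd_snd (A B : X) : tprd A B ;; fmap T π2 = π2.
Proof.
rewrite -(pairm_snd (ctc_prod X) (fmap T π1) (fmap T π2)).
by rewrite compA tprdK comp1m.
Qed.

Lemma Tpair_fst (Y A B : X) (f : hom Y (T A)) (g : hom Y (T B)) :
  Tpair f g ;; fmap T π1 = f.
Proof. by rewrite /Tpair -compA tprd_fst pairm_fst. Qed.

Lemma Tpair_snd (Y A B : X) (f : hom Y (T A)) (g : hom Y (T B)) :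
  Tpair f g ;; fmap T π2 = g.
Proof. by rewrite /Tpair -compA tprd_snd pairm_snd. Qed.

Lemma TpairE (Y A B : X) (k : hom Y (T (A ⊗ B))) :
  k = Tpair (k ;; fmap T π1) (k ;; fmap T π2).
Proof. by rewrite /Tpair -pair_pre -compA tprdVK compm1. Qed.

Lemma Tpair_eq (Y A B : X) (u v : hom Y (T (A ⊗ B))) :
  u ;; fmap T π1 = v ;; fmap T π1 -> u ;; fmap T π2 = v ;; fmap T π2 -> u = v.
Proof. by move=> e1 e2; rewrite (TpairE u) (TpairE v) e1 e2. Qed.

Lemma Tpair_pre (Z Y A B : X) (k : hom Z Y) (f : hom Y (T A)) (g : hom Y (T B)) :
  k ;; Tpair f g = Tpair (k ;; f) (k ;; g).
Proof. by rewrite /Tpair compA pair_pre. Qed.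

Lemma fmap_pair (Z Y A B : X) (k : hom Z (T Y)) (f : hom Y A) (g : hom Y B) :
  k ;; fmap T ⟨f, g⟩ = Tpair (k ;; fmap T f) (k ;; fmap T g).
Proof.
by apply: Tpair_eq;
  rewrite -compA -fmapM ?pairm_fst ?pairm_snd ?Tpair_fst ?Tpair_snd.
Qed.

Lemma Tpair_p (Y A B : X) (f : hom Y (T A)) (g : hom Y (T B)) :
  Tpair f g ;; tp T _ = ⟨f ;; tp T _, g ;; tp T _⟩.
Proof.
by apply: pair_eq; rewrite -compA -(tp_nat TP) compA ?pairm_fst ?pairm_snd
  ?Tpair_fst ?Tpair_snd.
Qed.

Lemma Tpair_z (Y A B : X) (f : hom Y A) (g : hom Y B) :
  ⟨f, g⟩ ;; tz T _ = Tpair (f ;; tz T _) (g ;; tz T _).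
Proof.
by apply: Tpair_eq; rewrite -compA -(tz_nat TP) compA ?pairm_fst ?pairm_snd
  ?Tpair_fst ?Tpair_snd.
Qed.

Lemma sum_is_Tpair (Y A B : X) (f g h : hom Y (T A)) (f' g' h' : hom Y (T B)) :
  sum_is f g h -> sum_is f' g' h' ->
  sum_is (Tpair f f') (Tpair g g') (Tpair h h').
Proof.
move=> sA sB; have [fp gp] := sum_is_p TP sA; have [fp' gp'] := sum_is_p TP sB.
have [|k sk] := @sum_is_ex _ _ TP _ _ (Tpair f f') (Tpair g g').
  by rewrite !Tpair_p fp gp fp' gp'.
suff <- : k = Tpair h h' by [].
apply: Tpair_eq.
  have := sum_is_fmap TP π1 sk; rewrite !Tpair_fst => /(sum_isE TP); exact.
have := sum_is_fmap TP π2 sk; rewrite !Tpair_snd => /(sum_isE TP); exact.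
Qed.

(** T of the isomorphism inverse to [tprd] reduces this to pairs of maps into [T (T A)] and
    [T (T B)]. *)
Lemma TTpair_eq (Y A B : X) (u v : hom Y (T (T (A ⊗ B)))) :
  u ;; fmap T (fmap T π1) = v ;; fmap T (fmap T π1) ->
  u ;; fmap T (fmap T π2) = v ;; fmap T (fmap T π2) -> u = v.
Proof.
move=> e1 e2; rewrite -(compm1 u) -(compm1 v) -fmap1 -tprdVK fmapM !compA.
by rewrite !fmap_pair e1 e2.
Qed.

Lemma Tpair_tprd_fst (Y A B : X) (f : hom Y (T (T A))) (g : hom Y (T (T B))) :
  Tpair f g ;; fmap T (tprd A B) ;; fmap T (fmap T π1) = f.
Proof. by rewrite -compA -fmapM tprd_fst Tpair_fst. Qed.

Lemma Tpair_tprd_snd (Y A B : X) (f : hom Y (T (T A))) (g : hom Y (T (T B))) :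
  Tpair f g ;; fmap T (tprd A B) ;; fmap T (fmap T π2) = g.
Proof. by rewrite -compA -fmapM tprd_snd Tpair_snd. Qed.

(** * Group objects and their tangent groups *)

Definition mul (B : X) (m : hom (B ⊗ B) B) (Y : X) (f g : hom Y B) : hom Y B :=
  ⟨f, g⟩ ;; m.

Lemma mul_pre (B : X) (m : hom (B ⊗ B) B) (Z Y : X) (k : hom Z Y)
    (f g : hom Y B) :
  k ;; mul m f g = mul m (k ;; f) (k ;; g).
Proof. by rewrite /mul compA pair_pre. Qed.

Lemma mul_proj (B : X) (m : hom (B ⊗ B) B) : mul m π1 π2 = m.
Proof.
rewrite -[RHS]comp1m /mul; congr (_ ;; _).
by rewrite (pairm_uniq (idm _)) !comp1m.
Qed.

(** A predicate on bare structure maps, phrased for generalized elements, so that it applies alike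
    to G, TG and TTG and permits calculation as in an ordinary group. *)
Record is_group (B : X) (m : hom (B ⊗ B) B) (e : hom (one (ctc_prod X)) B)
    (i : hom B B) : Prop := IsGroup {
  mulA : forall (Y : X) (f g h : hom Y B),
    mul m f (mul m g h) = mul m (mul m f g) h;
  mul1 : forall (Y : X) (f : hom Y B), mul m (!Y ;; e) f = f;
  mulI : forall (Y : X) (f : hom Y B), mul m f (!Y ;; e) = f;
  mulV : forall (Y : X) (f : hom Y B), mul m (f ;; i) f = !Y ;; e;
  mulVr : forall (Y : X) (f : hom Y B), mul m f (f ;; i) = !Y ;; e }.

Lemma group_objectP (G : group_object X) :
  is_group (gmul G) (gunit G) (ginv G).
Proof.
by split=> *; rewrite /mul ?(gmulA, gmul1m, gmulm1, gmulVm, gmulmV).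
Qed.

Lemma unt_pre (B : X) (e : hom (one (ctc_prod X)) B) (Z Y : X) (k : hom Z Y) :
  k ;; (!Y ;; e) = !Z ;; e.
Proof. by rewrite compA; congr (_ ;; _); apply: bang_eq. Qed.

Definition tmul (B : X) (m : hom (B ⊗ B) B) : hom (T B ⊗ T B) (T B) :=
  tprd B B ;; fmap T m.
Definition tunit (B : X) (e : hom (one (ctc_prod X)) B) :
  hom (one (ctc_prod X)) (T B) := tone X ;; fmap T e.

Lemma tmulE (B : X) (m : hom (B ⊗ B) B) (Y : X) (f g : hom Y (T B)) :
  mul (tmul m) f g = Tpair f g ;; fmap T m.
Proof. by rewrite /mul /tmul /Tpair compA. Qed.

Lemma fmap_mul (B : X) (m : hom (B ⊗ B) B) (Z Y : X) (k : hom Z (T Y))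
    (f g : hom Y B) :
  k ;; fmap T (mul m f g) = mul (tmul m) (k ;; fmap T f) (k ;; fmap T g).
Proof. by rewrite tmulE /mul fmapM compA fmap_pair. Qed.

Lemma fmap_unt (B : X) (e : hom (one (ctc_prod X)) B) (Z Y : X)
    (k : hom Z (T Y)) :
  k ;; fmap T (!Y ;; e) = !Z ;; tunit e.
Proof. by rewrite fmapM /tunit !compA; congr (_ ;; _); apply: Tone_eq. Qed.

(** T preserves finite products, so each axiom is the image under T of its generic instance, at the
    projections or at the identity, precomposed with arbitrary elements. *)
Lemma tangent_group (B : X) (m : hom (B ⊗ B) B) (e : hom (one (ctc_prod X)) B)
    (i : hom B B) :
  is_group m e i -> is_group (tmul m) (tunit e) (fmap T i).
Proof.
move=> gr; split=> Y f.
- move=> g h; have := mulA gr (π1 : hom (B ⊗ (B ⊗ B)) B) (π2 ;; π1) (π2 ;; π2).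
  move=> /(congr1 (fun k => Tpair f (Tpair g h) ;; fmap T k)).
  by rewrite !fmap_mul !fmapM !compA !Tpair_fst !Tpair_snd Tpair_fst.
- have := congr1 (fun k => f ;; fmap T k) (mul1 gr (idm B)).
  by rewrite fmap_mul fmap_unt fmap1 compm1.
- have := congr1 (fun k => f ;; fmap T k) (mulI gr (idm B)).
  by rewrite fmap_mul fmap_unt fmap1 compm1.
- have := congr1 (fun k => f ;; fmap T k) (mulV gr (idm B)).
  by rewrite fmap_mul fmap_unt fmap1 compm1 comp1m.
- have := congr1 (fun k => f ;; fmap T k) (mulVr gr (idm B)).
  by rewrite fmap_mul fmap_unt fmap1 compm1 comp1m.
Qed.

Definition is_ghom (B B' : X) (m : hom (B ⊗ B) B) (m' : hom (B' ⊗ B') B')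
    (φ : hom B B') : Prop :=
  forall (Y : X) (f g : hom Y B), mul m f g ;; φ = mul m' (f ;; φ) (g ;; φ).

Section GroupMorphisms.
Context (B B' : X) (m : hom (B ⊗ B) B) (m' : hom (B' ⊗ B') B').
Context (e : hom (one (ctc_prod X)) B) (e' : hom (one (ctc_prod X)) B').
Context (i : hom B B) (i' : hom B' B').
Context (gr : is_group m e i) (gr' : is_group m' e' i').
Context (φ : hom B B') (hφ : is_ghom m m' φ).

(** The image of the unit is idempotent, and in a group this forces it to be the unit. *)
Lemma ghom_unt (Y : X) : !Y ;; e ;; φ = !Y ;; e'.
Proof.
have idem : mul m' (!Y ;; e ;; φ) (!Y ;; e ;; φ) = !Y ;; e ;; φ.
  by rewrite -hφ (mul1 gr).
by rewrite -[LHS](mul1 gr') -(mulV gr' (!Y ;; e ;; φ)) -(mulA gr') idem.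
Qed.

Lemma fmap_ghom : is_ghom (tmul m) (tmul m') (fmap T φ).
Proof.
move=> Y f g; rewrite !tmulE -compA -fmapM.
have -> : m ;; φ = mul m' (π1 ;; φ) (π2 ;; φ).
  by rewrite -hφ mul_proj.
by rewrite fmap_mul !fmapM !compA Tpair_fst Tpair_snd tmulE.
Qed.

End GroupMorphisms.

(** * Tangent structure maps and additions as group homomorphisms *)

Section StructureMaps.
Context (B : X) (m : hom (B ⊗ B) B).

Lemma tp_ghom : is_ghom (tmul m) m (tp T B).
Proof. by move=> Y f g; rewrite tmulE -compA (tp_nat TP) compA Tpair_p. Qed.

Lemma tz_ghom : is_ghom m (tmul m) (tz T B).
Proof. by move=> Y f g; rewrite tmulE -Tpair_z -!compA (tz_nat TP). Qed.

Lemma ttmulE (Y : X) (f g : hom Y (T (T B))) :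
  mul (tmul (tmul m)) f g
  = Tpair f g ;; fmap T (tprd B B) ;; fmap T (fmap T m).
Proof. by rewrite tmulE fmapM compA. Qed.

Lemma tl_ghom : is_ghom (tmul m) (tmul (tmul m)) (tl T B).
Proof.
move=> Y f g; rewrite tmulE ttmulE -compA (tl_nat TP) compA; congr (_ ;; _).
apply: TTpair_eq; rewrite ?Tpair_tprd_fst ?Tpair_tprd_snd -compA -(tl_nat TP);
  by rewrite compA ?Tpair_fst ?Tpair_snd.
Qed.

Lemma tc_ghom : is_ghom (tmul (tmul m)) (tmul (tmul m)) (tc T B).
Proof.
move=> Y f g; rewrite !ttmulE -compA (tc_nat TP) compA; congr (_ ;; _).
apply: TTpair_eq; rewrite ?Tpair_tprd_fst ?Tpair_tprd_snd -compA -(tc_nat TP);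
  by rewrite compA ?Tpair_tprd_fst ?Tpair_tprd_snd.
Qed.

(** An interchange law: addition is natural, hence commutes with T of the multiplication, and sums
    in a product are formed componentwise. *)
Lemma sum_is_mul (Y : X) (f g h f' g' h' : hom Y (T B)) :
  sum_is f g h -> sum_is f' g' h' ->
  sum_is (mul (tmul m) f f') (mul (tmul m) g g') (mul (tmul m) h h').
Proof.
by move=> s1 s2; rewrite !tmulE; apply: (sum_is_fmap TP); apply: sum_is_Tpair.
Qed.

End StructureMaps.

(** Conjugation by the homomorphism [c] reduces the addition of Tp to the previous interchange
    law. *)
Lemma Tsum_is_mul (B : X) (m : hom (B ⊗ B) B) (Y : X)
    (f g h f' g' h' : hom Y (T (T B))) :
  Tsum_is f g h -> Tsum_is f' g' h' ->
  Tsum_is (mul (tmul (tmul m)) f f') (mul (tmul (tmul m)) g g')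
    (mul (tmul (tmul m)) h h').
Proof.
move=> /(Tsum_is_c TP) s1 /(Tsum_is_c TP) s2.
have := sum_is_c TP (sum_is_mul (tmul m) s1 s2).
by rewrite -!(@tc_ghom B m) -!compA (tc_c TP) !compm1.
Qed.


Lemma group_negation (B : X) (m : hom (B ⊗ B) B)
    (e : hom (one (ctc_prod X)) B) (i : hom B B) :
  is_group m e i -> exists n, @is_negation _ T B n.
Proof.
move=> gr; have gr' := tangent_group gr.
set w := tp T B ;; tz T B.
(* - v is 0_x v^-1 0_x for v over x. *)
exists (mul (tmul m) (mul (tmul m) w (fmap T i)) w); split.
  rewrite !tp_ghom (tp_nat TP) /w -!compA (tz_p TP) compm1.
  by rewrite (mulVr gr) (mul1 gr).
have s0 : sum_is (idm (T B)) w (idm (T B)).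
  by have := sum_isx0 TP (idm (T B)); rewrite comp1m.
have sV : sum_is (w ;; fmap T i) (fmap T i) (fmap T i).
  by have := sum_is_fmap TP i (tsumC TP s0); rewrite comp1m.
(* Interchange for (v + 0)(0 + v^-1)(0 + 0) = v v^-1 0 = 0: the first summands multiply to v 0^-1 0
   = v, the second ones to 0 v^-1 0. *)
have := sum_is_mul m (sum_is_mul m s0 sV) (sum_is0 TP (tp T B)).
rewrite -/w -(mulA gr') (mulV gr') (mulI gr').
have -> : fmap T i = idm _ ;; fmap T i by rewrite comp1m.
by rewrite (mulVr gr') (mul1 gr').
Qed.

(** * The differential structure of the Lie algebra *)

Section LieGroup.
Context (G : lie_group X).
Notation g := (lie G).
Notation ι := (liei G).
Notation m := (gmul G).
Notation e := (gunit G).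
Notation p := (tp T).
Notation z := (tz T).
Notation l := (tl T).
Notation c := (tc T).

Lemma liei_inj (Y : X) (u v : hom Y g) : u ;; ι = v ;; ι -> u = v.
Proof.
by move=> uv; apply: (is_pullback_eq (lie_pullback G 0)) => //; apply: bang_eq.
Qed.

Lemma Tliei_inj (Y : X) (u v : hom Y (T g)) :
  u ;; fmap T ι = v ;; fmap T ι -> u = v.
Proof.
by move=> uv; apply: (is_pullback_eq (lie_pullback G 1)) => //; apply: Tone_eq.
Qed.

Lemma liei_p (Y : X) (u : hom Y g) : u ;; ι ;; p G = !Y ;; e.
Proof.
by rewrite -compA (proj1 (lie_pullback G 0)) /= unt_pre.
Qed.

Lemma liei_lift (Y : X) (f : hom Y (T G)) :
  f ;; p G = !Y ;; e -> exists u, u ;; ι = f.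
Proof.
by move=> /(proj2 (lie_pullback G 0) _ _) [u [[uf _] _]]; exists u.
Qed.

Lemma unt_z (Y : X) : !Y ;; e ;; z G = !Y ;; z _ ;; fmap T e.
Proof. by rewrite -!compA (tz_nat TP). Qed.

Lemma Tliei_Tp (Y : X) (W : hom Y (T g)) :
  W ;; fmap T ι ;; fmap T (p G) = !Y ;; e ;; z G.
Proof.
rewrite -compA (proj1 (lie_pullback G 1)) unt_z compA; congr (_ ;; _).
exact: Tone_eq.
Qed.

Lemma lie_add_spec : sum_is (π1 ;; ι) (π2 ;; ι) (lie_add G ;; ι).
Proof.
have [|h sh] := @sum_is_ex _ _ TP G (g ⊗ g) (π1 ;; ι) (π2 ;; ι).
  by rewrite !liei_p.
have [|u uh] := @liei_lift _ h; first by rewrite -(proj1 (sum_is_p TP sh)) liei_p.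
pose P (a : hom (g ⊗ g) g) := sum_is (π1 ;; ι) (π2 ;; ι) (a ;; ι).
have Pu : P u by rewrite /P uh.
exact: the_hom_spec Pu.
Qed.

Lemma lie_lift_spec : lie_lift G ;; fmap T ι = ι ;; l G.
Proof.
have [|u [[uf _] _]] := proj2 (lie_pullback G 1) _ (ι ;; l G) (!g ;; z _).
  rewrite /= -unt_z -compA (tl_Tp TP) compA; congr (_ ;; _).
  by rewrite -(comp1m ι) liei_p.
pose P (v : hom g (T g)) := v ;; fmap T ι = ι ;; l G.
exact: (@the_hom_spec _ _ _ _ P u uf).
Qed.

(** Seen in TTG, [lie_split] is the decomposition of the vertical lift into a zero part and a lifted
    part, so its invertibility follows from universality there. *)
Lemma lie_split_spec (Y : X) (x w : hom Y g) :
  Tsum_is (x ;; ι ;; z (T G)) (w ;; ι ;; l G)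
    (⟨x, w⟩ ;; lie_split G ;; fmap T ι).
Proof.
have := Tsum_is_pre (Tpair (x ;; z g) (w ;; lie_lift G))
  (fmap_sum_is lie_add_spec).
have -> : ⟨x, w⟩ ;; lie_split G
    = Tpair (x ;; z g) (w ;; lie_lift G) ;; fmap T (lie_add G).
  by rewrite /lie_split compA Tpair_pre !compA pairm_fst pairm_snd.
rewrite !fmapM !compA Tpair_fst Tpair_snd -(compA w) lie_lift_spec.
by rewrite -(compA x) -(tz_nat TP) !compA.
Qed.

Lemma lie_split_inj (Y : X) (u v : hom Y (g ⊗ g)) :
  u ;; lie_split G = v ;; lie_split G -> u = v.
Proof.
rewrite (pairm_uniq u) (pairm_uniq v) => uv.
have := lie_split_spec (u ;; π1) (u ;; π2); rewrite uv.
move=> /(Tsum_is_lift_inj TP) /(_ (lie_split_spec _ _)) [].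
by move=> /liei_inj -> /liei_inj ->.
Qed.

(** The image of W in TTG projects under Tp to the zero vector at the unit, so its vertical part
    lies over the unit and factors through ι. *)
Lemma lie_split_ex (Y : X) (W : hom Y (T g)) :
  exists w, ⟨W ;; p g, w⟩ ;; lie_split G = W.
Proof.
have [k [sk /liei_lift [w wk]]] := Tsum_is_lift_ex TP (Tliei_Tp W).
exists w; apply: Tliei_inj; apply: (Tsum_isE TP) (lie_split_spec _ _) _.
by rewrite wk; rewrite -(compA W _ (p (T G))) (tp_nat TP) !compA in sk.
Qed.

Lemma lie_split_inv_spec :
  lie_split_inv G ;; lie_split G = idm _ /\
  lie_split G ;; lie_split_inv G = idm _.
Proof.
have [w wK] := lie_split_ex (idm (T g)).
pose P (v : hom (T g) (g ⊗ g)) :=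
  v ;; lie_split G = idm _ /\ lie_split G ;; v = idm _.
have Pw : P ⟨idm _ ;; p g, w⟩.
  by split=> //; apply: lie_split_inj; rewrite -compA wK compm1 comp1m.
exact: the_hom_spec Pw.
Qed.

(** Characterizes the differential projection by the vertical part in TTG, which is the form in
    which [ad] is computed. *)
Lemma diff_proj_spec (Y : X) (W : hom Y (T g)) :
  Tsum_is (W ;; fmap T ι ;; p (T G) ;; z (T G))
    (W ;; diff_proj G ;; ι ;; l G) (W ;; fmap T ι).
Proof.
have [w wW] := lie_split_ex W.
have -> : W ;; diff_proj G = w.
  rewrite -[in LHS]wW /diff_proj compA -(compA _ (lie_split G)).
  by rewrite (proj2 lie_split_inv_spec) compm1 pairm_snd.
rewrite -(compA W _ (p (T G))) (tp_nat TP) !compA.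
by have := lie_split_spec (W ;; p g) w; rewrite wW.
Qed.

(** * Adjoint action, left-invariant fields and the bracket *)

Notation "f ⋅ h" := (mul m f h) (at level 52, left associativity).
Notation "f ⋆ h" := (mul (tmul m) f h) (at level 52, left associativity).
Notation "f ⋆⋆ h" :=
  (mul (tmul (tmul m)) f h) (at level 52, left associativity).

Lemma conj_actionE : conj_action G = π1 ⋅ π2 ⋅ (π1 ;; ginv G).
Proof. by rewrite mul_proj. Qed.

(** T of conjugation in G is conjugation in the group TG, here by the zero vector over g. The result
    lies over g e g^-1 = e, so it factors through ι. *)
Lemma Ad_spec :
  Ad G ;; ι = (π1 ;; z G) ⋆ (π2 ;; ι) ⋆ (π1 ;; z G ;; fmap T (ginv G)).
Proof.
have gr := group_objectP G.
set k := RHS.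
have kE : k = Tpair (π1 ;; z G) (π2 ;; ι) ;; fmap T (conj_action G).
  by rewrite conj_actionE !fmap_mul fmapM compA Tpair_fst Tpair_snd.
have [|u uk] := @liei_lift _ k.
  rewrite /k !tp_ghom liei_p -(compA _ (fmap T (ginv G))) (tp_nat TP) compA.
  by rewrite -(compA π1 (z G)) (tz_p TP) compm1 (mulI gr) (mulVr gr).
pose P (a : hom (G ⊗ g) g) :=
  a ;; ι = Tpair (π1 ;; z G) (π2 ;; ι) ;; fmap T (conj_action G).
rewrite kE; apply: (@the_hom_spec _ _ _ _ P u).
by rewrite /P -kE.
Qed.

Lemma univ_plivfE (Y : X) (f : hom Y G) (h : hom Y g) :
  ⟨f, h⟩ ;; univ_plivf G = (f ;; z G) ⋆ (h ;; ι).
Proof.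
by rewrite tmulE /univ_plivf compA Tpair_pre !compA pairm_fst pairm_snd.
Qed.

(** Evaluation of both fields at the unit of G recovers b and b', because [z G] sends the unit to
    the unit of TG. *)
Lemma univ_plivf_inj (Y : X) (b b' : hom Y g) :
  ⟨π1, π2 ;; b⟩ ;; univ_plivf G
  = ⟨π1 : hom (G ⊗ Y) G, π2 ;; b'⟩ ;; univ_plivf G ->
  b = b'.
Proof.
move=> bb'; apply: liei_inj.
have gr := group_objectP G.
move/(congr1 (fun k => ⟨!Y ;; e, idm Y⟩ ;; k)): bb'.
rewrite !univ_plivfE !mul_pre !compA pairm_fst pairm_snd !comp1m.
rewrite (ghom_unt gr (tangent_group gr) (@tz_ghom _ m)).
by rewrite !(mul1 (tangent_group gr)).
Qed.

Lemma liei_Tz_p (Y : X) (a : hom Y g) :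
  a ;; ι ;; fmap T (z G) ;; p (T G) = !Y ;; tunit e.
Proof.
have gr := group_objectP G; rewrite -compA (tp_nat TP) compA liei_p.
exact: (ghom_unt gr (tangent_group gr) (@tz_ghom _ m)).
Qed.

(** T of [Ad_spec] turns the derivative of [Ad] into conjugation by A in TTG, and [diff_proj_spec]
    extracts its vertical part. *)
Lemma ad_spec (Y : X) (a b : hom Y g) :
  let A := a ;; ι ;; fmap T (z G) in
  let B := b ;; ι ;; z (T G) in
  Tsum_is B (⟨a, b⟩ ;; ad G ;; ι ;; l G)
    (A ⋆⋆ B ⋆⋆ (A ;; fmap T (fmap T (ginv G)))).
Proof.
move=> A B; have gr := tangent_group (group_objectP G).
set W := Tpair (a ;; ι) (b ;; z g) ;; fmap T (Ad G).
have WE : W ;; fmap T ι = A ⋆⋆ B ⋆⋆ (A ;; fmap T (fmap T (ginv G))).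
  rewrite /W -compA -fmapM Ad_spec !fmap_mul !fmapM !compA Tpair_fst Tpair_snd.
  by rewrite -(compA b) -(tz_nat TP) compA.
have -> : ⟨a, b⟩ ;; ad G = W ;; diff_proj G.
  rewrite /ad /W compA compA Tpair_pre !compA.
  by rewrite pairm_fst pairm_snd.
suff Wp : W ;; fmap T ι ;; p (T G) = b ;; ι.
  by rewrite -WE /B -Wp; apply: diff_proj_spec.
have Ap : A ;; p (T G) = !Y ;; tunit e by apply: liei_Tz_p.
rewrite WE !tp_ghom -(compA A) (tp_nat TP) compA Ap (mul1 gr).
(* The inverse of the unit is written as the unit times its inverse, which [mulVr] collapses to the
   unit. *)
rewrite -(mul1 gr (_ ;; fmap T (ginv G))) (mulVr gr) (mulI gr).
by rewrite -compA (tz_p TP) compm1.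
Qed.

Lemma plivf_bracket_left (Y : X) (x : hom Y G) (a b : hom Y g)
    (F1 F2 : hom Y (T (T G))) :
  F1 = x ;; z G ;; fmap T (z G) ⋆⋆ (a ;; ι ;; fmap T (z G))
         ⋆⋆ (b ;; ι ;; z (T G)) ->
  F2 = x ;; z G ;; fmap T (z G) ⋆⋆ (b ;; ι ;; z (T G))
         ⋆⋆ (a ;; ι ;; fmap T (z G)) ->
  tbrace (tsub F1 F2) = (x ;; z G) ⋆ (⟨a, b⟩ ;; ad G ;; ι).
Proof.
have gr := group_objectP G; have gr1 := tangent_group gr.
have gr2 := tangent_group gr1.
set A := a ;; ι ;; fmap T (z G); set B := b ;; ι ;; z (T G).
set o := x ;; z G ;; fmap T (z G); set w := ⟨a, b⟩ ;; ad G ;; ι.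
move=> F1E F2E.
have adS : Tsum_is B (w ;; l G) (A ⋆⋆ B ⋆⋆ (A ;; fmap T (fmap T (ginv G)))).
  exact: ad_spec.
set AB := A ⋆⋆ B ⋆⋆ _ in adS.
set D := o ⋆⋆ AB.
have oz : o = x ;; z G ;; z (T G).
  by rewrite /o -!compA (tz_nat TP).
(* Here o + o = o for the addition of Tp, so multiplying by B + L gives oB + oL. The summand oB is a
   zero vector and oL the lift of the field of [ad] at x. *)
have DS : Tsum_is ((x ;; z G ⋆ (b ;; ι)) ;; z (T G)) ((x ;; z G ⋆ w) ;; l G) D.
  rewrite (@tz_ghom _ (tmul m)) (@tl_ghom _ m) -oz -(compA x) (tz_l TP) compA.
  apply: Tsum_is_mul => //.
  have := Tsum_is_l TP (sum_is0 TP x).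
  by rewrite -compA (tz_l TP) compA.
have Ap : A ;; p (T G) = !Y ;; tunit e by apply: liei_Tz_p.
have DF : D ⋆⋆ A = F1.
  by rewrite F1E /D /AB -!(mulA gr2) (mulV gr2) (mulI gr2).
have [Dp _] := Tsum_is_lift_p TP DS.
have [n nP] := group_negation gr.
suff DFF : tsub F1 F2 = D.
  by rewrite DFF; apply: (tbraceE TP); rewrite Dp.
apply: (tsubE TP nP).
(* As A lies over the unit of TG, the zero vector over its base point is the unit of TTG. *)
have sA : sum_is (!Y ;; tunit (tunit e)) A A.
  rewrite -(ghom_unt gr1 gr2 (@tz_ghom _ (tmul m))) -Ap.
  exact: (tsum0m TP).
have sD : sum_is D ((x ;; z G ⋆ (b ;; ι)) ;; z (T G)) D.
  by rewrite -Dp; apply: (sum_isx0 TP).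
(* Interchange applied to (D + oB)(1 + A) gives D A = D + o B A, that is, F1 = D + F2. *)
have := sum_is_mul (tmul m) sD sA; rewrite DF (mulI gr2).
by rewrite (@tz_ghom _ (tmul m)) -oz -F2E.
Qed.

Lemma ad_bracket :
  ⟨π1, π2 ;; ad G⟩ ;; univ_plivf G
  = plivf_bracket (⟨π1, π2 ;; π1⟩ ;; univ_plivf G)
      (⟨π1, π2 ;; π2⟩ ;; univ_plivf G).
Proof.
rewrite univ_plivfE; symmetry.
have -> : π2 ;; ad G = ⟨π2 ;; π1, π2 ;; π2⟩ ;; ad G :> hom (G ⊗ (g ⊗ g)) g.
  by rewrite -pairm_uniq.
have zι (h : hom (g ⊗ g) g) :
    (π2 : hom (G ⊗ (g ⊗ g)) _) ;; z (g ⊗ g) ;; fmap T h ;; fmap T ι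
    = π2 ;; h ;; ι ;; z (T G).
  by rewrite -!compA -fmapM -(tz_nat TP) !compA.
apply: plivf_bracket_left;
  rewrite !univ_plivfE !fmap_mul !fmapM !compA Tpair_fst Tpair_snd zι;
  rewrite (fmap_ghom (@tz_ghom _ m)); first by [].
(* Only the second term carries [c]. Being a homomorphism that exchanges [z (T G)] and
   [fmap T (z G)], it turns the two factors into B and A and preserves the zero vector over x. *)
have zc : z (T G) ;; c G = fmap T (z G) by exact: (tz_c TP).
rewrite !(@tc_ghom _ m) -!(compA _ _ (c G)) zc (Tz_c TP).
by rewrite -(compA π1 (z G) (z (T G))) (tz_nat TP) compA.
Qed.

Lemma lie_bracketE (b : hom (g ⊗ g) g) :
  ⟨π1, π2 ;; b⟩ ;; univ_plivf G
  = plivf_bracket (⟨π1, π2 ;; π1⟩ ;; univ_plivf G)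
      (⟨π1, π2 ;; π2⟩ ;; univ_plivf G) ->
  lie_bracket G = b.
Proof.
pose P (b' : hom (g ⊗ g) g) := ⟨π1, π2 ;; b'⟩ ;; univ_plivf G
  = plivf_bracket (⟨π1, π2 ;; π1⟩ ;; univ_plivf G)
      (⟨π1, π2 ;; π2⟩ ;; univ_plivf G).
move=> Pb; apply: (@the_hom_eq _ _ _ _ P) => // b' Pb'.
by apply: univ_plivf_inj; rewrite Pb' Pb.
Qed.

End LieGroup.

End Products.

Theorem theorem5p8 (X : cartesian_tangent_category) (G : lie_group X) :
  lie_bracket G = ad G.
Proof. exact: lie_bracketE (ad_bracket G). Qed.
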